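(* Let $\Phi$ be an irreducible crystallographic root system of rank $n$ with Weyl group $W$ and affine Weyl group $\widetilde{W}=W\ltimes\mathbb{Z}\Phi^\vee$. The flag $h$-vector of the reduced Steinberg torus $\Sigma'_T(\widetilde W)$ satisfies the generalized Dehn–Sommerville equations: for all $J\subseteq\{0,1,\dots,n\}$, $$h_J(\Sigma'_T(\widetilde W))=h_{\{0,\dots,n\}\setminus J}(\Sigma'_T(\widetilde W)).$$ In particular, the affine Eulerian polynomial is symmetric: $\widetilde W(t)=t^{n+1}\widetilde W(1/t)$.
   Context: Setting: $\Phi$ is an irreducible crystallographic root system in a real Euclidean space $V$ with inner product $\langle\cdot,\cdot\rangle$; $\alpha_1,\dots,\alpha_n$ is a fixed set of simple roots, assumed to span $V$; $W$ is the finite Weyl group; $\widetilde\alpha$ is the highest root and $\alpha_0:=-\widetilde\alpha$. Write $[0,n]=\{0,1,\dots,n\}$. $\mathbb{Z}\Phi^\vee$ is the lattice generated by the co-roots $\beta^\vee=2\beta/\langle\beta,\beta\rangle$, acting on $V$ by translations; $\widetilde W=W\ltimes\mathbb{Z}\Phi^\vee$. For $w\in W$, the affine descent set is $\widetilde{\mathrm{Des}}(w):=\{j\in[0,n]:w\alpha_j<0\}$ (where $\beta<0$ means $\beta$ is a negative root), and the univariate affine Eulerian polynomial is $\widetilde W(t):=\sum_{w\in W}t^{|\widetilde{\mathrm{Des}}(w)|}$. Affine Coxeter complex: the hyperplanes $\{\lambda\in V:\langle\lambda,\beta\rangle=k\}$ ($\beta\in\Phi$, $k\in\mathbb{Z}$)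 partition $V$ into the open cells of a simplicial complex $\Sigma(\widetilde W)$ (which also includes the empty face). For $J\subseteq[0,n]$ let $A_J$ be the set of all $\lambda\in V$ such that: $\langle\lambda,\alpha_j\rangle=0$ for $j\in J\setminus\{0\}$; $\langle\lambda,\alpha_j\rangle>0$ for $j\in\{1,\dots,n\}\setminus J$; and $\langle\lambda,\widetilde\alpha\rangle=1$ if $0\in J$, $\langle\lambda,\widetilde\alpha\rangle<1$ if $0\notin J$. Every cell has the form $\mu+wA_J$ with $\mu\in\mathbb{Z}\Phi^\vee$, $w\in W$, $J\subseteq[0,n]$ ($J=[0,n]$ giving the empty face). The vertices $\mu+wA_{[0,n]\setminus\{j\}}$ are given color $j$; then the vertices of $\mu+wA_J$ have color-set $[0,n]\setminus J$, without repetition. Steinberg torus: the quotient cell complex $\Sigma_T(\widetilde W)=\Sigma(\widetilde W)/\mathbb{Z}\Phi^\vee$ (a finite Boolean cell complex, whose cells inherit color-sets). The reduced Steinberg torus $\Sigma'_T(\widetilde W)$ is obtained from it by deleting the empty cell of dimension $-1$. For such a finite colored complex $\Sigma$, $f_J(\Sigma)$ is the number of cells with color-set $J$ (so $f_\varnothing(\Sigma'_T(\widetilde W))=0$), and the flag $h$-vector has components $h_J(\Sigma):=\sum_{I\subseteq J}(-1)^{|J\setminus I|}f_I(\Sigma)$ for $J\subseteq[0,n]$. *)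

(* Defs.v *)
From HB Require Import structures.
From mathcomp Require Import all_boot all_order all_algebra.
From mathcomp Require Import finmap.
From mathcomp Require Import boolp classical_sets functions cardinality fsbigop.
From mathcomp Require Import reals.

Set Implicit Arguments.
Unset Strict Implicit.
Unset Printing Implicit Defensive.

Import Order.TTheory GRing.Theory Num.Theory.

Local Open Scope classical_set_scope.
Local Open Scope ring_scope.

Section RootSystems.

Context {R : realType} {V : vectType R} (dot : {dot V for idfun}).

Definition reflection (b v : V) : V := v - (2 * dot v b / dot b b) *: b.

Definition coroot (b : V) : V := (2 / dot b b) *: b.

(* A finite set of vectors is given as a sequence; only membership in [Phi]
   matters below, neither the order nor the multiplicities. *)
Record root_system (Phi : seq V) : Prop := RootSystem {
  root_neq0 : 0 \notin Phi;
  root_span : <<Phi>>%VS = fullv;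
  root_reflection : forall a b, a \in Phi -> b \in Phi ->
    reflection a b \in Phi;
  root_reduced : forall a (c : R), a \in Phi -> c *: a \in Phi ->
    c = 1 \/ c = -1;
  root_crystallographic : forall a b, a \in Phi -> b \in Phi ->
    2 * dot b a / dot a a \is a Num.int
}.

Definition irreducible_root_system (Phi : seq V) : Prop :=
  Phi <> [::] /\
  forall A B : seq V, Phi =i A ++ B ->
    (forall a b, a \in A -> b \in B -> dot a b = 0) ->
    A = [::] \/ B = [::].

Definition nneg_comb n (alpha : n.-tuple V) (v : V) : Prop :=
  exists c : 'I_n -> nat, v = \sum_(i < n) tnth alpha i *+ c i.

Record simple_system (Phi : seq V) n (alpha : n.-tuple V) : Prop :=
  SimpleSystem {
  simple_root : {subset alpha <= Phi};
  simple_basis : basis_of fullv alpha;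
  simple_sign : forall b, b \in Phi ->
    nneg_comb alpha b \/ nneg_comb alpha (- b)
}.

Definition negative_root (Phi : seq V) n (alpha : n.-tuple V) (b : V) : Prop :=
  b \in Phi /\ nneg_comb alpha (- b).

Definition highest_root (Phi : seq V) n (alpha : n.-tuple V) (theta : V) :
    Prop :=
  theta \in Phi /\ forall b, b \in Phi -> nneg_comb alpha (theta - b).

Inductive weyl_group (Phi : seq V) : (V -> V) -> Prop :=
| weyl_id : weyl_group Phi id
| weyl_reflection b w : b \in Phi -> weyl_group Phi w ->
    weyl_group Phi (reflection b \o w).

Definition coroot_lattice (Phi : seq V) (mu : V) : Prop :=
  inIntSpan (in_tuple (map coroot Phi)) mu.

End RootSystems.

Section AffineDescents.

Context {R : realType} {V : vectType R} (dot : {dot V for idfun}).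
Context (Phi : seq V) {n : nat} (alpha : n.-tuple V) (theta : V).

(* The index set [0,n] is 'I_n.+1: the index [ord0] stands for -theta and
   [lift ord0 i] for the i-th simple root (so [tnth alpha] is 0-based). *)
Definition aff_simple (j : 'I_n.+1) : V :=
  if unlift ord0 j is Some i then tnth alpha i else - theta.

Definition aff_descents (w : V -> V) : {set 'I_n.+1} :=
  [set j | `[< negative_root Phi alpha (w (aff_simple j)) >]]%SET.

(* [\sum_(w \in _)] has the value 0 when its support is infinite, which does
   not occur here since a Weyl group is finite. *)
Definition aff_eulerian : {poly int} :=
  \sum_(w \in weyl_group dot Phi) ('X^#|aff_descents w| : {poly int}).

End AffineDescents.

Section SteinbergTorus.

Context {R : realType} {V : vectType R} (dot : {dot V for idfun}).
Context (Phi : seq V) {n : nat} (alpha : n.-tuple V) (theta : V).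

(* The points [x] and [y] lie on the same side of, or both on, each of the
   hyperplanes <_, b> = k. *)
Definition same_cell (x y : V) : Prop :=
  forall b (k : int), b \in Phi ->
    Num.sg (dot x b - k%:~R) = Num.sg (dot y b - k%:~R).

(* Cells are open cells, i.e. subsets of V; the empty face is [set0]. *)
Definition coxeter_cell (s : set V) : Prop :=
  s = set0 \/ exists x, s = [set y | same_cell x y].

Definition translate (mu : V) (s : set V) : set V := [set mu + x | x in s].

Definition alcove_face (J : {set 'I_n.+1}) : set V :=
  [set x | (forall i : 'I_n, if lift ord0 i \in J
                             then dot x (tnth alpha i) = 0
                             else 0 < dot x (tnth alpha i))
         /\ (if ord0 \in J then dot x theta = 1 else dot x theta < 1)].

Definition vertex_colored (j : 'I_n.+1) (t : set V) : Prop :=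
  exists mu w, [/\ coroot_lattice dot Phi mu, weyl_group dot Phi w &
    t = translate mu (w @` alcove_face (~: [set j])%SET)].

(* The topological closure, for the norm given by the inner product. *)
Definition cell_closure (s : set V) : set V :=
  [set x | forall e : R, 0 < e -> exists2 y, s y & dot (x - y) (x - y) < e].

Definition color_set (s : set V) : {set 'I_n.+1} :=
  [set j | `[< exists2 t, vertex_colored j t & t `<=` cell_closure s >]]%SET.

(* The image of a cell in the quotient by the lattice, as a set of cells. *)
Definition torus_class (s : set V) : set (set V) :=
  [set translate mu s | mu in coroot_lattice dot Phi].

Definition steinberg_torus : set (set (set V)) :=
  [set torus_class s | s in coxeter_cell].

Definition reduced_steinberg_torus : set (set (set V)) :=
  steinberg_torus `\ torus_class set0.

Definition torus_color (c : set (set V)) (J : {set 'I_n.+1}) : Prop :=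
  exists2 s, coxeter_cell s & c = torus_class s /\ color_set s = J.

(* The set of cells that is counted is finite, so that [fset_set] is faithful
   (it would return the empty set on an infinite set). *)
Definition flag_f (S : set (set (set V))) (J : {set 'I_n.+1}) : nat :=
  #|` fset_set [set c | S c /\ torus_color c J]|.

Definition flag_h (S : set (set (set V))) (J : {set 'I_n.+1}) : int :=
  \sum_(I : {set 'I_n.+1} | I \subset J) (-1) ^+ #|(J :\: I)%SET| * (flag_f S I)%:Z.

End SteinbergTorus.

(* Main.v *)
Require Import Defs.
From HB Require Import structures.
From mathcomp Require Import all_boot all_order all_algebra.
From mathcomp Require Import finmap.
From mathcomp Require Import boolp classical_sets functions cardinality fsbigop.
From mathcomp Require Import reals.
From mathcomp Require Import ring lra.

Set Implicit Arguments.
Unset Strict Implicit.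
Unset Printing Implicit Defensive.

Import Order.TTheory GRing.Theory Num.Theory.

Local Open Scope ring_scope.

(* An element of W whose affine descent set is contained in J labels a cell
   of color J of the Steinberg torus, namely the class of w A_{~: J}.  This is
   a bijection: every cell of color J is the class of some w A_{~: J}, where w
   is unique up to the stabilizer of A_{~: J}, and exactly one choice of w makes
   a generic dominant vector rho at a point of w A_{~: J} point into the alcove
   w A.  Hence f_J counts the w with descents in J and, by Moebius inversion,
   h_J counts the w with descent set J.  Left multiplication by the longest
   element exchanges the descent sets J and ~: J.

   The underlying facts on the affine Weyl group (it acts simply transitively
   on alcoves, and the closed alcove is a strict fundamental domain) are proved
   for words in the simple affine reflections, via the exchange property; it
   rests on the fact that only the j-th wall separates the alcove from its image
   under the j-th simple affine reflection. *)

(** * Affine functionals and reflections *)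

Section Euclidean.

Context {R : realType} {V : vectType R} (dot : {dot V for idfun}).
Implicit Types (x y u v b : V) (f r : V * R).

Lemma dotC u v : dot u v = dot v u.
Proof. by rewrite hermC /= expr0 mul1r. Qed.

Lemma dotDl u v x : dot (u + v) x = dot u x + dot v x.
Proof. exact: linearDl. Qed.

Lemma dotZl (c : R) u x : dot (c *: u) x = c * dot u x.
Proof. exact: linearZl_LR. Qed.

Lemma dotNl u x : dot (- u) x = - dot u x.
Proof. exact: linearNl. Qed.

Lemma dotDr u v x : dot x (u + v) = dot x u + dot x v.
Proof. by rewrite dotC dotDl !(dotC x). Qed.

Lemma dotZr (c : R) u x : dot x (c *: u) = c * dot x u.
Proof. by rewrite dotC dotZl !(dotC x). Qed.

Lemma dotNr u x : dot x (- u) = - dot x u.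
Proof. by rewrite dotC dotNl !(dotC x). Qed.

Definition dotE := (dotDl, dotDr, dotZl, dotZr, dotNl, dotNr).

Lemma dot0l x : dot 0 x = 0.
Proof. by rewrite -(scale0r 0) dotZl mul0r. Qed.

Lemma dot0r x : dot x 0 = 0.
Proof. by rewrite dotC dot0l. Qed.

Lemma dot_gt0 x : x != 0 -> 0 < dot x x.
Proof. exact: neq0_dnorm_gt0. Qed.

Lemma dot_ge0 x : 0 <= dot x x.
Proof. by have [->|/dot_gt0/ltW//] := eqVneq x 0; rewrite dot0l. Qed.

Lemma dot_sumr (I : finType) (F : I -> V) x :
  dot x (\sum_i F i) = \sum_i dot x (F i).
Proof. exact: (big_morph _ (fun u v => dotDr u v x) (dot0r x)). Qed.

Lemma dot_CS u v : dot u v ^+ 2 <= dot u u * dot v v.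
Proof.
have [->|v0] := eqVneq v 0; first by rewrite !dot0r mulr0 expr0n.
have vv := dot_gt0 v0.
have := dot_ge0 (dot v v *: u - dot u v *: v).
rewrite !dotE (dotC v u) => H.
have : 0 <= dot v v * (dot u u * dot v v - dot u v ^+ 2) by move: H; lra.
by rewrite pmulr_rge0// subr_ge0.
Qed.

(* An affine functional <_, b> + k is encoded by the pair (b, k). *)
Definition aff f x : R := dot x f.1 + f.2.

Definition aff_refl f x : V := x - aff f x *: coroot dot f.1.

(** The pullback of [f] along the affine reflection in [r], so that reflections act on affine roots
    as well as on points. *)
Definition refl_aff r f : V * R :=
  (f.1 - dot (coroot dot r.1) f.1 *: r.1,
   f.2 - dot (coroot dot r.1) f.1 * r.2).

Lemma corootE b : coroot dot b = (2 / dot b b) *: b.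
Proof. by []. Qed.

Lemma reflectionE b v : reflection dot b v = v - dot (coroot dot b) v *: b.
Proof. by rewrite /reflection /coroot !dotE (dotC b v) mulrAC. Qed.

Lemma dot_coroot b : b != 0 -> dot (coroot dot b) b = 2.
Proof.
by move=> /dot_gt0 b0; rewrite corootE dotZl divfK// gt_eqF.
Qed.

Lemma aff_subZ f x (t : R) v : aff f (x - t *: v) = aff f x - t * dot v f.1.
Proof. by rewrite /aff !dotE; ring. Qed.

Lemma aff_add f x v : aff f (x + v) = aff f x + dot v f.1.
Proof. by rewrite /aff !dotE; ring. Qed.

Lemma aff_refl_aff r f x : aff (refl_aff r f) x = aff f (aff_refl r x).
Proof. by rewrite /aff_refl aff_subZ /aff /= !dotE; ring. Qed.

Lemma aff_self_refl f x : f.1 != 0 -> aff f (aff_refl f x) = - aff f x.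
Proof. by move=> f0; rewrite /aff_refl aff_subZ dot_coroot//; ring. Qed.

Lemma aff_reflK f x : f.1 != 0 -> aff_refl f (aff_refl f x) = x.
Proof.
move=> f0; rewrite {1}/aff_refl aff_self_refl// /aff_refl scaleNr opprK.
by rewrite subrK.
Qed.

Lemma aff_refl_fix f x : aff f x = 0 -> aff_refl f x = x.
Proof. by rewrite /aff_refl => ->; rewrite scale0r subr0. Qed.

Lemma dot_reflection b u v : b != 0 ->
  dot (reflection dot b u) (reflection dot b v) = dot u v.
Proof.
move=> /dot_gt0 b0; rewrite !reflectionE corootE !dotE (dotC b v) (dotC u b).
by field; rewrite gt_eqF.
Qed.

Lemma reflectionZ b (t : R) u : reflection dot b (t *: u) = t *: reflection dot b u.
Proof. by rewrite !reflectionE !dotE scalerBr scalerA. Qed.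

Lemma reflectionK b v : b != 0 -> reflection dot b (reflection dot b v) = v.
Proof.
move=> /dot_coroot b0; rewrite !reflectionE.
move: (coroot dot b) b0 => c cb; rewrite !dotE cb.
rewrite -addrA -opprD -scalerDl.
set t := dot _ v; have -> : t + (t - t * 2) = 0 by ring.
by rewrite scale0r subr0.
Qed.

Lemma coroot_reflection b v : b != 0 ->
  coroot dot (reflection dot b v) = reflection dot b (coroot dot v).
Proof. by move=> b0; rewrite !corootE dot_reflection// reflectionZ. Qed.

Lemma corootN b : coroot dot (- b) = - coroot dot b.
Proof. by rewrite !corootE !dotE opprK scalerN. Qed.

Lemma reflection_coroot b v : reflection dot b v = v - dot v b *: coroot dot b.
Proof.
by rewrite reflectionE corootE dotZl scalerA (dotC v) [in RHS]mulrC.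
Qed.

Lemma aff_refl_subZ r x (t : R) v :
  aff_refl r (x - t *: v) = aff_refl r x - t *: reflection dot r.1 v.
Proof.
rewrite /aff_refl aff_subZ reflection_coroot; move: (coroot dot r.1) => c.
rewrite scalerBl scalerBr !scalerA !opprB addrACA [RHS]addrACA; congr (_ + _).
by rewrite addrC.
Qed.

(** Conjugating by a reflection moves the mirror. This is how a word for one reflection yields words
    for the conjugate ones, and how a letter is deleted in [exchange]. *)
Lemma refl_aff_conj r f x : r.1 != 0 ->
  aff_refl (refl_aff r f) x = aff_refl r (aff_refl f (aff_refl r x)).
Proof.
move=> r0; rewrite [aff_refl f _]/aff_refl aff_refl_subZ aff_reflK//.
by rewrite [LHS]/aff_refl aff_refl_aff /= -reflectionE coroot_reflection.
Qed.

Lemma refl_affK r f : r.1 != 0 -> refl_aff r (refl_aff r f) = f.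
Proof.
move=> r0; rewrite [RHS]surjective_pairing /refl_aff /= -!reflectionE reflectionK//.
congr pair; have := dot_coroot r0; rewrite reflectionE; move: (coroot dot r.1) => c cb.
by rewrite dotDr dotNr dotZr cb; ring.
Qed.

Definition opp_aff f : V * R := (- f.1, - f.2).

Lemma affN f x : aff (opp_aff f) x = - aff f x.
Proof. by rewrite /aff /= dotNr opprD. Qed.

Lemma aff_reflN f x : aff_refl (opp_aff f) x = aff_refl f x.
Proof. by rewrite /aff_refl affN corootN scalerN scaleNr opprK. Qed.

End Euclidean.

(** * Moebius inversion over subsets *)

(** Applied to one Weyl group element at a time, [D] being its descent set, this inverts the passage
    from exact descent sets to descent sets contained in [I]. *)
Lemma moebius_subsets (T : finType) (D J : {set T}) :
  \sum_(I : {set T} | I \subset J) (-1) ^+ #|(J :\: I)%SET| * (D \subset I)%:Z =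
  (D == J)%:Z.
Proof.
have [DJ|DJ] := boolP (D \subset J); last first.
  rewrite big1 => [|I IJ]; last first.
    suff /negPf-> : ~~ (D \subset I) by rewrite mulr0.
    by apply: contra DJ => /fintype.subset_trans; exact.
  by case: eqVneq DJ => // ->; rewrite fintype.subxx.
have [->|DnJ] := eqVneq D J.
  rewrite (bigD1 J)//= fintype.subxx finset.setDv cards0 mulr1 big1 ?addr0// => I /andP[IJ InJ].
  suff /negPf-> : ~~ (J \subset I) by rewrite mulr0.
  by apply: contra InJ => JI; rewrite finset.eqEsubset IJ.
have [x xJ xD] : exists2 x, x \in J & x \notin D.
  by apply/fintype.subsetPn; move: DnJ; rewrite finset.eqEsubset DJ.
(* Toggling the element x is a sign-reversing involution. *)
pose h (I : {set T}) := if x \in I then I :\ x else x |: I.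
have hK : involutive h.
  move=> I; rewrite /h; case: (boolP (x \in I)) => xI; rewrite !inE eqxx /=.
    exact: finset.setD1K.
  exact: finset.setU1K.
rewrite (bigID (fun I : {set T} => x \in I)) /= addrC.
rewrite (reindex_inj (can_inj hK)) /=.
have hE I : (h I \subset J) && (x \notin h I) = (I \subset J) && (x \in I).
  rewrite /h; case: (boolP (x \in I)) => xI; rewrite !inE eqxx /= ?andbF// !andbT.
  apply/idP/idP => [H|]; last by apply: fintype.subset_trans; exact: finset.subD1set.
  by rewrite -(finset.setD1K xI) finset.subUset finset.sub1set xJ.
rewrite (eq_bigl _ _ hE) -big_split big1//= => I /andP[IJ xI].
rewrite /h xI finset.subsetD1 xD andbT.
have -> : J :\: (I :\ x) = x |: (J :\: I).
  by apply/setP => y; rewrite !inE; case: eqVneq => // ->; rewrite xI xJ.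
rewrite cardsU1 !inE xI /= exprS; ring.
Qed.

(** * Affine roots and the fundamental alcove *)

Section AffineRoots.

Context {R : realType} {V : vectType R} (dot : {dot V for idfun}).
Context (Phi : seq V) (Phi_root : root_system dot Phi).
Implicit Types (x y b : V) (f r : V * R).

Lemma root_nz b : b \in Phi -> b != 0.
Proof. by apply: contraTneq => ->; exact: root_neq0 Phi_root. Qed.

Lemma root_opp b : b \in Phi -> - b \in Phi.
Proof.
move=> bP; have := root_reflection Phi_root bP bP.
by rewrite reflectionE dot_coroot ?root_nz// scaler_nat mulr2n opprD addrA subrr sub0r.
Qed.

Lemma root_int b c : b \in Phi -> c \in Phi -> dot (coroot dot b) c \is a Num.int.
Proof.
move=> bP cP; have := root_crystallographic Phi_root bP cP.
by rewrite corootE dotZl mulrAC (dotC _ c).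
Qed.

Definition aff_root f := f.1 \in Phi /\ f.2 \is a Num.int.

Lemma aff_root_nz f : aff_root f -> f.1 != 0.
Proof. by case=> /root_nz. Qed.

Lemma aff_root_refl r f : aff_root r -> aff_root f -> aff_root (refl_aff dot r f).
Proof.
move=> [r1 r2] [f1 f2]; split => /=.
  by rewrite -reflectionE; apply: (root_reflection Phi_root).
by rewrite rpredB// rpredM// root_int.
Qed.

Lemma aff_root_opp f : aff_root f -> aff_root (opp_aff f).
Proof. by move=> [f1 f2]; split; rewrite /= ?root_opp ?rpredN. Qed.

Context {n : nat} (alpha : n.-tuple V) (theta : V).
Context (alpha_simple : simple_system Phi alpha).
Context (theta_highest : highest_root Phi alpha theta).
Implicit Types (i : 'I_n) (j : 'I_n.+1).

Local Notation aff_simple := (aff_simple alpha theta).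

(** The walls of the alcove, oriented inwards: [<x, alpha_i>], and [1 - <x, theta>] at index
    [ord0]. *)
Definition sroot j : V * R := (aff_simple j, (j == ord0)%:R).

Lemma aff_simple0 : aff_simple ord0 = - theta.
Proof. by rewrite /Defs.aff_simple unlift_none. Qed.

Lemma aff_simple_lift i : aff_simple (lift ord0 i) = tnth alpha i.
Proof. by rewrite /Defs.aff_simple liftK. Qed.

Lemma simple_in i : tnth alpha i \in Phi.
Proof. by apply: (simple_root alpha_simple); exact: mem_tnth. Qed.

Lemma sroot_root j : aff_root (sroot j).
Proof.
split; last by rewrite /=; case: eqP.
rewrite /=; case: (unliftP ord0 j) => [i|] ->.
  by rewrite aff_simple_lift simple_in.
by rewrite aff_simple0 root_opp//; case: theta_highest.
Qed.

Lemma sroot_nz j : (sroot j).1 != 0.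
Proof. exact: aff_root_nz (sroot_root j). Qed.

Lemma simple_coord_inj (c d : 'I_n -> R) :
  \sum_i c i *: tnth alpha i = \sum_i d i *: tnth alpha i -> c =1 d.
Proof.
have /andP[_ fr] := simple_basis alpha_simple.
move=> E i; have := congr1 (coord alpha i) E.
by under eq_bigr do rewrite (tnth_nth 0); under [X in _ = _ X]eq_bigr do rewrite (tnth_nth 0);
  rewrite !coord_sum_free.
Qed.

Lemma sum_aff_simple (m : 'I_n.+1 -> R) :
  \sum_j m j *: aff_simple j =
  - (m ord0 *: theta) + \sum_i m (lift ord0 i) *: tnth alpha i.
Proof.
rewrite big_ord_recl aff_simple0 scalerN; congr (_ + _).
by apply: eq_bigr => i _; rewrite aff_simple_lift.
Qed.

Lemma nneg_combE v : nneg_comb alpha v ->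
  exists2 c : 'I_n -> R, (forall i, 0 <= c i) &
    v = \sum_i c i *: tnth alpha i.
Proof.
move=> [c ->]; exists (fun i => (c i)%:R) => [i|]; first exact: ler0n.
by apply: eq_bigr => i _; rewrite scaler_nat.
Qed.

(** The marks are the coordinates of [theta]. They are positive because subtracting any simple root
    from [theta] still leaves a nonnegative combination. *)
Lemma marks : exists c : 'I_n.+1 -> R,
  [/\ forall j, 0 < c j, c ord0 = 1 & \sum_j c j *: aff_simple j = 0].
Proof.
have [thP high] := theta_highest.
have [c c0 Ec] : exists2 c : 'I_n -> R, (forall i, 0 < c i) &
    theta = \sum_i c i *: tnth alpha i.
  have sE i : tnth alpha i = \sum_k (k == i)%:R *: tnth alpha k.
    rewrite (bigD1 i)//= eqxx scale1r big1 ?addr0// => k /negPf->.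
    by rewrite scale0r.
  have [d Ed] : exists d : 'I_n -> R, theta = \sum_i d i *: tnth alpha i.
    exists (coord alpha ^~ theta).
    under eq_bigr do rewrite (tnth_nth 0).
    by apply: coord_basis; [exact: simple_basis alpha_simple|exact: memvf].
  exists d => // i.
  have [e e0 Ee] := nneg_combE (high _ (simple_in i)).
  have : \sum_k d k *: tnth alpha k = \sum_k (e k + (k == i)%:R) *: tnth alpha k.
    under [RHS]eq_bigr do rewrite scalerDl.
    by rewrite big_split /= -Ee -sE subrK.
  by move/simple_coord_inj/(_ i) => /= ->; rewrite eqxx ltr_wpDl.
exists (fun j => if unlift ord0 j is Some i then c i else 1); split.
- by move=> j; case: (unliftP ord0 j) => [i|] _.
- by rewrite unlift_none.
- rewrite sum_aff_simple unlift_none scale1r.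
  by under eq_bigr do rewrite liftK; rewrite -Ec addNr.
Qed.

(** The nonnegative combinations of the walls [sroot j]. Only [sroot ord0] has a constant term,
    hence the second component. *)
Definition aff_pos f := exists2 m : 'I_n.+1 -> R, (forall j, 0 <= m j) &
  f = (\sum_j m j *: aff_simple j, m ord0).

Lemma aff_sum (m : 'I_n.+1 -> R) x :
  aff dot (\sum_j m j *: aff_simple j, m ord0) x = \sum_j m j * aff dot (sroot j) x.
Proof.
rewrite /aff /= dot_sumr.
under [RHS]eq_bigr do rewrite mulrDr.
rewrite big_split /=; congr (_ + _).
  by apply: eq_bigr => j _; rewrite dotZr.
rewrite (bigD1 ord0)//= mulr1 big1 ?addr0// => j /negPf->.
by rewrite mulr0.
Qed.

(** The marks express the constant functional 1 as a combination of the walls; [k] times it is added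
    to the expansion of [b]. *)
Lemma aff_pos_mk b (k : R) : nneg_comb alpha b -> 0 <= k -> aff_pos (b, k).
Proof.
move=> /nneg_combE[c c0 Eb] k0; have [d [d0 d1]] := marks.
rewrite sum_aff_simple d1 scale1r => /eqP; rewrite addrC subr_eq0 => /eqP Ed.
exists (fun j => if unlift ord0 j is Some i then c i + k * d (lift ord0 i) else k).
  by move=> j; case: unlift => // i; rewrite addr_ge0// mulr_ge0// ltW.
rewrite sum_aff_simple unlift_none; congr pair.
under eq_bigr do rewrite liftK scalerDl -scalerA.
by rewrite big_split /= -scaler_sumr Ed -Eb addrCA addNr addr0.
Qed.

(** Split off one copy of the wall [(- theta, 1)]: what remains is [(theta + b, k - 1)], and
    [theta + b] is a nonnegative combination because [- b] is a root. *)
Lemma aff_pos_mk1 b (k : R) : b \in Phi -> 1 <= k -> aff_pos (b, k).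
Proof.
move=> bP k1; have [thP high] := theta_highest.
have nn : nneg_comb alpha (theta + b) by rewrite -[b]opprK; exact/high/root_opp.
have [|m m0 [E1 E2]] := aff_pos_mk (k := k - 1) nn _; first by rewrite subr_ge0.
exists (fun j => m j + (j == ord0)%:R) => [j|]; first by rewrite addr_ge0.
rewrite eqxx -E2 subrK; congr pair.
under eq_bigr do rewrite scalerDl.
rewrite big_split /= -E1 (bigD1 ord0)//= ?eqxx scale1r aff_simple0.
rewrite big1 => [|j /negPf->]; last by rewrite scale0r.
by rewrite addr0 addrC addKr.
Qed.

Lemma int_ge0_or (k : R) : k \is a Num.int -> 0 <= k \/ 1 <= - k.
Proof.
move=> /intrP[z ->]; have [z0|z0] := leP 0 z; [left|right].
  by rewrite ler0z.
by rewrite -rmorphN -[1]/(1%:~R) ler_int -gtz0_ge1 oppr_gt0.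
Qed.

(** The affine analogue of [simple_sign]; it implies that no hyperplane cuts the alcove. Integrality
    of the constant term excludes values strictly between -1 and 0. *)
Lemma aff_pos_or f : aff_root f -> aff_pos f \/ aff_pos (opp_aff f).
Proof.
move: f => [b k] [/= bP kZ].
have [nb|nb] := simple_sign alpha_simple bP.
- have [k0|k0] := int_ge0_or kZ; first by left; exact: aff_pos_mk.
  by right; exact/aff_pos_mk1/k0/root_opp.
- have [] := @int_ge0_or (- k); first by rewrite rpredN.
    by right; exact: aff_pos_mk.
  by rewrite opprK; left; exact: aff_pos_mk1.
Qed.

(** In rank 0 the relation between the marks would read [theta = 0]. Positive rank ensures that
    every wall has a nonempty open facet. *)
Lemma rank_gt0 : (0 < n)%N.
Proof.
rewrite lt0n; apply/eqP => n0; have [c [_ c1]] := marks.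
rewrite sum_aff_simple c1 scale1r big1 => [|i _]; last by have := ltn_ord i; rewrite [X in (_ < X)%N]n0.
rewrite addr0 => /eqP; rewrite oppr_eq0; apply/negP.
by apply: root_nz; case: theta_highest.
Qed.

(** * Faces of the alcove and signs of affine roots on them *)

Definition alcove x := forall j, 0 < aff dot (sroot j) x.
Definition closed_alcove x := forall j, 0 <= aff dot (sroot j) x.
Definition face (J : {set 'I_n.+1}) x := forall j,
  if j \in J then aff dot (sroot j) x = 0 else 0 < aff dot (sroot j) x.

Lemma alcove_closed x : alcove x -> closed_alcove x.
Proof. by move=> ax j; exact/ltW. Qed.

Lemma face_closed J x : face J x -> closed_alcove x.
Proof. by move=> fx j; have := fx j; case: ifP => _; [move=> ->|move/ltW]. Qed.

Lemma face0 x : face finset.set0 x <-> alcove x.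
Proof.
by split=> fx j; have := fx j; rewrite inE.
Qed.

(** The summands are the barycentric coordinates of [x] with respect to the vertices of the
    alcove. *)
Lemma aff_marks : exists c : 'I_n.+1 -> R,
  [/\ forall j, 0 < c j, c ord0 = 1 & forall x, \sum_j c j * aff dot (sroot j) x = 1].
Proof.
have [c [c0 c1 E]] := marks; exists c; split=> // x.
by rewrite -aff_sum E c1 /aff dot0r add0r.
Qed.

(** The Gram matrix of a basis is invertible: a kernel vector gives a combination of simple roots
    orthogonal to all of them, hence to itself. *)
Lemma simple_dual (c : 'I_n -> R) : exists x, forall i, dot x (tnth alpha i) = c i.
Proof.
pose G := \matrix_(i < n, j < n) dot (tnth alpha i) (tnth alpha j).
have GE (u : 'rV[R]_n) i :
    (u *m G) 0 i = dot (\sum_k u 0 k *: tnth alpha k) (tnth alpha i).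
  rewrite mxE dotC dot_sumr; apply: eq_bigr => k _.
  by rewrite mxE dotZr dotC.
have GU : G \in unitmx.
  rewrite -row_free_unit; apply: inj_row_free => u uG.
  set v := \sum_k u 0 k *: tnth alpha k.
  have v0 : v = 0.
    apply/eqP; apply: contraT => /(dot_gt0 dot).
    rewrite {2}/v dot_sumr big1 ?ltxx// => i _.
    by rewrite dotZr -GE uG mxE mulr0.
  apply/rowP => i; rewrite mxE.
  have := @simple_coord_inj (u 0) (fun=> 0); apply.
  rewrite -/v v0; under eq_bigr do rewrite scale0r.
  by rewrite big1.
exists (\sum_k ((\row_i c i) *m invmx G) 0 k *: tnth alpha k) => i.
by rewrite -GE mulmxKV// mxE.
Qed.

Lemma face_nonempty J : J != [set: 'I_n.+1]%SET -> exists x, face J x.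
Proof.
move=> JT; have [c [c0 c1 cE]] := aff_marks.
have [j0 j0J] : exists j, j \notin J.
  by apply/existsP; move: JT; apply: contraNT; rewrite negb_exists => /forallP H;
    apply/eqP/setP => j; rewrite inE; exact/negPn.
(* All walls outside [J] get the same value [1 / N], normalized to satisfy the relation of
   [aff_marks]. That relation then forces the value at index [ord0], the others being prescribed
   through [simple_dual]. *)
pose N := \sum_(j | j \notin J) c j.
have N0 : 0 < N.
  rewrite /N (bigD1 j0)//= ltr_pwDl// sumr_ge0// => j _; exact/ltW.
pose y (j : 'I_n.+1) := (j \notin J)%:R / N.
have yE : \sum_j c j * y j = 1.
  rewrite -[RHS](divff (lt0r_neq0 N0)) [X in _ = X / _]big_mkcond mulr_suml.
  by apply: eq_bigr => j _; rewrite /y mulrA; case: ifP; rewrite ?mulr1 ?mulr0.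
have [x xE] := simple_dual (fun i => y (lift ord0 i)).
have xE1 i : aff dot (sroot (lift ord0 i)) x = y (lift ord0 i).
  by rewrite /aff /= aff_simple_lift addr0.
exists x => j; have -> : aff dot (sroot j) x = y j.
  case: (unliftP ord0 j) => [i|] ->; first exact: xE1.
  have := cE x; rewrite -yE !big_ord_recl.
  under eq_bigr do rewrite xE1.
  by move=> /addIr/mulfI; apply; exact: lt0r_neq0.
by rewrite /y; case: (j \in J) => /=; rewrite ?mul0r// mul1r invr_gt0.
Qed.

Lemma alcove_nonempty : exists x, alcove x.
Proof.
have [|x /face0] := @face_nonempty finset.set0; last by exists x.
by apply/eqP => /setP/(_ ord0); rewrite !inE.
Qed.

Lemma aff_pos_ge0 f x : aff_pos f -> closed_alcove x -> 0 <= aff dot f x.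
Proof.
by move=> [m m0 ->] cx; rewrite aff_sum sumr_ge0// => j _; exact: mulr_ge0.
Qed.

Lemma aff_pos_eq0 (m : 'I_n.+1 -> R) J x : (forall j, 0 <= m j) -> face J x ->
  aff dot (\sum_j m j *: aff_simple j, m ord0) x = 0 ->
  forall j, j \notin J -> m j = 0.
Proof.
move=> m0 fx /eqP; rewrite aff_sum psumr_eq0 => [/allP H j jJ|j _].
  have := H j (mem_index_enum _); have := fx j; rewrite (negPf jJ) => /gt_eqF.
  by rewrite /= mulf_eq0 => ->; rewrite orbF => /eqP.
by rewrite mulr_ge0//; exact: face_closed fx j.
Qed.

Lemma aff_pos_gt0 f x : aff_root f -> aff_pos f -> alcove x -> 0 < aff dot f x.
Proof.
move=> fr fp ax; rewrite lt_neqAle aff_pos_ge0 ?andbT//; last exact: alcove_closed.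
apply/eqP => /esym f0; case: fp f0 fr => m m0 -> f0 /aff_root_nz.
have m_eq0 := aff_pos_eq0 m0 (iffRL (face0 x) ax) f0.
by rewrite /= big1 ?eqxx// => j _; rewrite m_eq0 ?inE// scale0r.
Qed.

Lemma alcove_pos f x : aff_root f -> alcove x -> 0 < aff dot f x -> aff_pos f.
Proof.
move=> fr ax fx; have [//|/aff_pos_gt0] := aff_pos_or fr.
by move=> /(_ _ (aff_root_opp fr) ax); rewrite affN oppr_gt0 ltNge ltW.
Qed.

Lemma alcove_neg f x : aff_root f -> alcove x -> aff dot f x < 0 -> aff_pos (opp_aff f).
Proof.
by move=> fr ax fx; apply: (alcove_pos (aff_root_opp fr) ax); rewrite affN oppr_gt0.
Qed.

Lemma alcove_regular f x : aff_root f -> alcove x -> aff dot f x != 0.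
Proof.
move=> fr ax; have [/(aff_pos_gt0 fr)/(_ ax)/gt_eqF->//|] := aff_pos_or fr.
move=> /(aff_pos_gt0 (aff_root_opp fr))/(_ ax).
by rewrite affN oppr_gt0 => /lt_eqF->.
Qed.

Local Notation srefl j := (aff_refl dot (sroot j)).

(* [f] vanishes on the open facet of the alcove in the j-th wall, which forces
   all coefficients of [f] but the j-th to be 0. *)
Lemma separating_simple f x j : aff_root f -> alcove x ->
  0 < aff dot f x -> aff dot f (srefl j x) < 0 -> f = sroot j.
Proof.
move=> fr ax fx; rewrite -aff_refl_aff => gx.
have gr := aff_root_refl (sroot_root j) fr.
have [|p pj] := @face_nonempty [set j]%SET.
  apply/eqP => jT; have := congr1 (fun A : {set _} => #|A|) jT.
  by rewrite /= cards1 cardsT card_ord => -[n0]; have := rank_gt0; rewrite -n0.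
have pc := face_closed pj.
have [m m0 fE] := alcove_pos fr ax fx.
(* The point [p] of the facet is fixed by the reflection, so [f] and its negative reflected
   functional take the same value there. *)
have fp0 : aff dot f p = 0.
  apply/eqP; rewrite eq_le; apply/andP; split.
    have := aff_pos_ge0 (alcove_neg gr ax gx) pc.
    rewrite affN oppr_ge0 aff_refl_aff aff_refl_fix//.
    by have := pj j; rewrite inE eqxx.
  by apply: aff_pos_ge0 pc; exists m.
rewrite fE in fp0; have mj k : k != j -> m k = 0.
  by move=> kj; apply: (aff_pos_eq0 m0 pj fp0); rewrite inE.
have f1 : f.1 = m j *: aff_simple j.
  rewrite fE /= (bigD1 j)//= big1 ?addr0// => k kj.
  by rewrite mj// scale0r.
(* Reducedness leaves only the factors 1 and -1. *)
have m1 : m j = 1.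
  have := fr.1; rewrite f1 => /(root_reduced Phi_root (sroot_root j).1)[//|mE].
  by have := m0 j; rewrite mE ler0N1.
rewrite [LHS]surjective_pairing f1 m1 scale1r; congr pair.
rewrite fE /=; by have [<-//|j0] := eqVneq; rewrite mj// eq_sym.
Qed.

(** * Words in the simple affine reflections *)

Definition word_act (s : seq 'I_n.+1) x := foldr (fun j => srefl j) x s.

Lemma word_act_cat s t x : word_act (s ++ t) x = word_act s (word_act t x).
Proof. exact: foldr_cat. Qed.

Lemma word_act_rev s x : word_act (rev s) (word_act s x) = x.
Proof.
elim: s => //= j s IH; rewrite rev_cons -cats1 word_act_cat /= aff_reflK//.
exact: sroot_nz.
Qed.

(** A simple reflection permutes the positive affine roots other than its own, since
    [separating_simple] leaves [sroot j] as the only one that it makes negative. *)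
Lemma refl_affP f j x : aff_root f -> alcove x -> 0 < aff dot f x ->
  f = sroot j \/ 0 < aff dot (refl_aff dot (sroot j) f) x.
Proof.
move=> fr ax fx; have gr := aff_root_refl (sroot_root j) fr.
have [lt0|gt0|/eqP] := ltgtP (aff dot (refl_aff dot (sroot j) f) x) 0.
- by left; apply: separating_simple fr ax fx _; rewrite -aff_refl_aff.
- by right.
- by rewrite (negPf (alcove_regular gr ax)).
Qed.

Lemma pos_minimum (I : finType) (F : I -> R) (p : I) : (forall q, 0 < F q) ->
  exists2 d, 0 < d & forall q, d <= F q.
Proof.
move=> F0; exists (F [arg min_(q < p) F q]%O); first exact: F0.
by case: Order.TotalTheory.arg_minP => // i _ H k; exact: H.
Qed.

(* Reflecting a non-simple [f] in a wall j with <f.1, alpha_j> > 0 keeps it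
   positive on the alcove and decreases its value at a fixed point there. *)
Lemma refl_word_pos f a : aff_root f -> alcove a -> 0 < aff dot f a ->
  exists s, word_act s =1 aff_refl dot f.
Proof.
move=> fr aa f0; have [d d0 dj] := pos_minimum ord0 aa.
(* Each reflection lowers the value at [a] by at least the smallest wall value [d], so [N] bounds
   the number of reflections. *)
have [N fN] : exists N : nat, aff dot f a < d * N%:R.
  exists (Num.bound (aff dot f a / d)).
  by rewrite mulrC -ltr_pdivrMr//; apply: archi_boundP; apply: divr_ge0; exact/ltW.
elim: N f fr f0 fN => [|N IH] f fr f0 fN; first by move: fN; rewrite mulr0 ltNge ltW.
(* Otherwise [f.1], a nonnegative combination of the [aff_simple j], would have nonpositive squared
   norm. *)
have [j fj] : exists j, 0 < dot (aff_simple j) f.1.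
  have [m m0 fE] := alcove_pos fr aa f0.
  apply/existsP; apply: contraT; rewrite negb_exists => /forallP H.
  have : dot f.1 f.1 <= 0.
    rewrite {2}fE /= dot_sumr sumr_le0// => j _; rewrite dotZr dotC.
    by rewrite mulr_ge0_le0// leNgt.
  by rewrite leNgt dot_gt0// (aff_root_nz fr).
have [->|g0] := refl_affP j fr aa f0; first by exists [:: j].
have sr := sroot_root j.
have [|s sE] := IH _ (aff_root_refl sr fr) g0.
  (* A positive integer is at least 1. *)
  have k1 : 1 <= dot (coroot dot (aff_simple j)) f.1.
    have [] := @int_ge0_or (- dot (coroot dot (aff_simple j)) f.1).
    - by rewrite rpredN root_int//; [case: sr|case: fr].
    - rewrite oppr_ge0 corootE dotZl leNgt => /negP[].
      by rewrite mulr_gt0// divr_gt0// dot_gt0// sroot_nz.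
    - by rewrite opprK.
  move: fN; rewrite aff_refl_aff /aff_refl aff_subZ /= -natr1 mulrDr mulr1.
  have := dj j; have := aa j; set u := aff dot (sroot j) a => u0 du.
  by have := ler_peMr (ltW u0) k1; lra.
exists (j :: s ++ [:: j]) => x /=; rewrite word_act_cat sE.
rewrite -refl_aff_conj ?refl_affK//; exact: sroot_nz.
Qed.

Lemma refl_word f : aff_root f -> exists s, word_act s =1 aff_refl dot f.
Proof.
move=> fr; have [a aa] := alcove_nonempty.
have [f0|f0|/eqP] := ltgtP (aff dot f a) 0.
- have [|s sE] := refl_word_pos (aff_root_opp fr) aa; first by rewrite affN oppr_gt0.
  by exists s => x; rewrite sE aff_reflN.
- exact: refl_word_pos fr aa f0.
- by rewrite (negPf (alcove_regular fr aa)).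
Qed.

Definition separating a y : set (V * R) :=
  [set f | [/\ aff_root f, 0 < aff dot f a & aff dot f y < 0]]%classic.

(** For a separating [(b, k)] the integer [k] lies between [- <a, b>] and [- <y, b>], which leaves
    finitely many [k] for each of the finitely many [b]. *)
Lemma separating_finite a y : finite_set (separating a y).
Proof.
pose M (b : V) := Num.bound (`|dot a b| + `|dot y b|).
pose F b := ((fun p : bool * nat => (b, (-1) ^+ p.1 * p.2%:R : R)) @`
  (setT `*` `I_(M b)))%classic.
apply: (@sub_finite_set _ _ (\bigcup_(b in [set` Phi]) F b)%classic).
  move=> [b k] [[/= bP /intrP[z zE]] fa fy]; exists b => //.
  exists (z < 0, `|z|%N) => /=; last by rewrite zE [in RHS](intEsign z) rmorphM rmorph_sign.
  split=> //=; rewrite -(ltr_nat R) natr_absz.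
  apply: le_lt_trans (archi_boundP _); last by rewrite addr_ge0.
  move: fa fy; rewrite /aff /= => fa fy.
  rewrite intr_norm -zE ler_norml.
  have := ler_norm (dot a b); have := ler_norm (- dot y b).
  by have := normr_ge0 (dot a b); have := normr_ge0 (dot y b); rewrite normrN => *;
    apply/andP; split; lra.
apply: bigcup_finite => [|b _]; first exact: finite_seq.
by apply: finite_image; apply: finite_setX => //; exact: finite_II.
Qed.

(** Reflecting [y] in a wall that it violates lowers the number of separating affine roots: those of
    the reflected point are carried injectively to those of [y], and [sroot j] is missed. *)
Lemma word_to_closed_alcove y : exists s, closed_alcove (word_act s y).
Proof.
have [a aa] := alcove_nonempty.
have [N] := ubnP #|` fset_set (separating a y)|.
elim: N y => // N IH y; rewrite ltnS => yN.
have [cy|] := pselect (closed_alcove y); first by exists [::].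
move=> /existsNP[j] /negP; rewrite -ltNge => jy.
have [|s sc] := IH (srefl j y); last by exists (s ++ [:: j]); rewrite word_act_cat.
apply: leq_trans yN; rewrite (cardfsD1 (sroot j) (fset_set (separating a y))).
have -> : sroot j \in fset_set (separating a y).
  rewrite in_fset_set; last exact: separating_finite.
  by rewrite inE; split => //; exact: sroot_root.
rewrite add1n ltnS; set A := fset_set _; set B := (_ `\ _)%fset.
have -> : #|` A| = #|` [fset refl_aff dot (sroot j) f | f in A]%fset|.
  rewrite card_in_imfset// => f g _ _ fg.
  by rewrite -(refl_affK dot f (sroot_nz j)) fg refl_affK// sroot_nz.
apply: fsubset_leq_card; apply/fsubsetP => _ /imfsetP[f /= fA ->].
  move: fA; rewrite in_fset_set; last exact: separating_finite.
  rewrite inE => -[fr fa fy].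
  have fj : f <> sroot j.
    by move=> E; move: fy; rewrite E aff_self_refl ?sroot_nz// oppr_lt0 ltNge ltW.
  rewrite !inE; apply/andP; split.
    apply/eqP => E; move: fa; rewrite -(refl_affK dot f (sroot_nz j)) E.
    by rewrite aff_refl_aff aff_self_refl ?sroot_nz// oppr_gt0 ltNge ltW.
  rewrite in_fset_set ?inE; last exact: separating_finite.
  split; last by rewrite aff_refl_aff.
    exact: aff_root_refl (sroot_root j) fr.
  by have [] := refl_affP j fr aa fa.
Qed.

(** Pull [f] back through the letters one by one. It changes sign at a letter [j] where it has
    become [sroot j]; deleting that letter amounts to reflecting in [f]. *)
Lemma exchange s f a : alcove a -> aff_root f ->
  0 < aff dot f a -> aff dot f (word_act s a) < 0 ->
  exists2 t, (size t < size s)%N & forall x, word_act t x = aff_refl dot f (word_act s x).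
Proof.
move=> aa; elim: s f => [|j s IH] f fr f0 /=; first by rewrite ltNge ltW.
have [->|g0] := refl_affP j fr aa f0.
  by move=> _; exists s => // x; rewrite aff_reflK// sroot_nz.
rewrite -aff_refl_aff => /(IH _ (aff_root_refl (sroot_root j) fr) g0)[t ts tE].
exists (j :: t) => //= x; rewrite tE refl_aff_conj ?sroot_nz//.
by rewrite aff_reflK// sroot_nz.
Qed.

Lemma word_pullback s f : aff_root f ->
  exists2 g, aff_root g & forall x, aff dot g x = aff dot f (word_act s x).
Proof.
elim: s f => [|j s IH] f fr; first by exists f.
have [g gr gE] := IH _ (aff_root_refl (sroot_root j) fr).
by exists g => // x; rewrite gE aff_refl_aff.
Qed.

(** The pullback of [sroot j] along [j :: s] has one sign on the whole alcove. If positive, wall [j]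
    separates the alcove from its image under [s], and [exchange] applies; if negative, the image
    under [j :: s] lies beyond wall [j]. *)
Lemma word_shorten j s : (exists2 t, (size t < size s)%N & word_act t =1 word_act (j :: s))
  \/ forall x, closed_alcove x -> let y := word_act (j :: s) x in
       aff dot (sroot j) y <= 0 /\ (alcove x -> aff dot (sroot j) y < 0).
Proof.
have [a aa] := alcove_nonempty; have [g gr gE] := word_pullback (j :: s) (sroot_root j).
have [g0|g0|/eqP] := ltgtP (aff dot g a) 0; last by rewrite (negPf (alcove_regular gr aa)).
- right=> x cx; have gp := alcove_neg gr aa g0; rewrite /= -[srefl j _]/(word_act (j :: s) x) -gE; split=> [|ax].
    by rewrite -oppr_ge0 -affN; exact: aff_pos_ge0.
  by rewrite -oppr_gt0 -affN; apply: aff_pos_gt0 => //; exact: aff_root_opp.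
- left; apply: (exchange aa (sroot_root j) (aa j)).
  by move: g0; rewrite gE /= aff_self_refl ?sroot_nz// oppr_gt0.
Qed.

Lemma closed_alcove_fixed s x :
  closed_alcove x -> closed_alcove (word_act s x) -> word_act s x = x.
Proof.
have [N] := ubnP (size s); elim: N s => // N IH [//|j s]; rewrite ltnS => sN cx cs.
have [[t ts tE]|H] := word_shorten j s.
  by rewrite -tE IH// ?tE//; apply: leq_trans ts (ltnW sN).
have [sx _] := H _ cx.
have sjx : aff dot (sroot j) (word_act (j :: s) x) = 0 by apply/le_anti; rewrite sx cs.
have := aff_refl_fix sjx; rewrite /= aff_reflK ?sroot_nz// => E.
by rewrite -E; apply: IH => //; rewrite E.
Qed.

(** Freeness of the action on alcoves: an image inside the open alcove is never beyond a wall, so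
    the word can be shortened until it is empty. *)
Lemma alcove_trivial s x : alcove x -> alcove (word_act s x) -> word_act s =1 id.
Proof.
have [N] := ubnP (size s); elim: N s => // N IH [//|j s]; rewrite ltnS => sN ax as_.
have [[t ts tE]|/(_ _ (alcove_closed ax))[_ /(_ ax)]] := word_shorten j s.
  move=> y; rewrite -tE; apply: IH ax _ _; last by rewrite tE.
  exact: leq_trans ts (ltnW sN).
by rewrite ltNge ltW.
Qed.

(** * The affine Weyl group *)

Local Notation W := (weyl_group dot Phi).
Local Notation L := (coroot_lattice dot Phi).
Implicit Types (mu : V) (w : V -> V) (J K : {set 'I_n.+1}).

Lemma weyl_comp w w' : W w -> W w' -> W (w \o w').
Proof. by move=> Ww Ww'; elim: Ww => // b v bP _ IH; exact: weyl_reflection bP IH. Qed.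

Lemma weyl_inv w : W w -> exists w', [/\ W w', cancel w w' & cancel w' w].
Proof.
elim=> [|b v bP Wv [v' [Wv' vK v'K]]]; first by exists id; split; [exact: weyl_id| |].
have rK := fun x => reflectionK dot x (root_nz bP).
exists (v' \o reflection dot b); split=> [|x|x] /=; rewrite ?rK ?v'K//.
exact/(weyl_comp Wv')/(weyl_reflection bP)/weyl_id.
Qed.

Lemma weyl_linear w (t : R) x y : W w -> w (t *: x + y) = t *: w x + w y.
Proof.
move=> Ww; elim: Ww x y => // b v bP _ IH x y /=; rewrite IH.
rewrite !reflectionE dotDr dotZr scalerDl scalerBr scalerA opprD.
by rewrite addrACA.
Qed.

Lemma weylD w x y : W w -> w (x + y) = w x + w y.
Proof. by move=> Ww; rewrite -[x]scale1r weyl_linear// !scale1r. Qed.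

Lemma weyl0 w : W w -> w 0 = 0.
Proof. by move=> Ww; apply: (addrI (w 0)); rewrite -weylD// !addr0. Qed.

Lemma weylZ w (t : R) x : W w -> w (t *: x) = t *: w x.
Proof. by move=> Ww; rewrite -[t *: x]addr0 weyl_linear// weyl0// addr0. Qed.

Lemma weylN w x : W w -> w (- x) = - w x.
Proof. by move=> Ww; rewrite -!scaleN1r weylZ. Qed.

Lemma weyl_dot w x y : W w -> dot (w x) (w y) = dot x y.
Proof. by elim=> // b v bP _ IH /=; rewrite dot_reflection ?root_nz. Qed.

Lemma weyl_root w b : W w -> b \in Phi -> w b \in Phi.
Proof. by move=> + bP; elim=> // c v cP _ IH; exact: (root_reflection Phi_root). Qed.

(** * The coroot lattice and its semidirect product with the Weyl group *)

Lemma latticeD mu nu : L mu -> L nu -> L (mu + nu).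
Proof.
move=> [a ->] [b ->]; exists [ffun k => a k + b k]; rewrite -big_split.
by apply: eq_bigr => k _; rewrite ffunE mulrzDr.
Qed.

Lemma latticeM mu (z : int) : L mu -> L (mu *~ z).
Proof.
move=> [a ->]; exists [ffun k => a k * z].
rewrite mulrz_suml.
by apply: eq_bigr => k _; rewrite ffunE mulrzA.
Qed.

Lemma latticeN mu : L mu -> L (- mu).
Proof. by move=> /(latticeM (-1)); rewrite mulrNz. Qed.

Lemma lattice0 : L 0.
Proof.
exists [ffun=> 0]; rewrite big1// => k _; by rewrite ffunE mulr0z.
Qed.

Lemma lattice_coroot b : b \in Phi -> L (coroot dot b).
Proof.
move=> bP; have bI : (index b Phi < size (map (coroot dot) Phi))%N by rewrite size_map index_mem.
exists [ffun k => (k == Ordinal bI)%:Z].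
rewrite (bigD1 (Ordinal bI))//= ffunE eqxx mulr1z big1 ?addr0 => [|k /negPf kb].
  by rewrite (nth_map 0) ?index_mem// nth_index.
by rewrite ffunE kb mulr0z.
Qed.

Lemma lattice_ind (P : V -> Prop) : P 0 -> (forall x y, P x -> P y -> P (x + y)) ->
  (forall x, P x -> P (- x)) -> (forall b, b \in Phi -> P (coroot dot b)) ->
  forall mu, L mu -> P mu.
Proof.
move=> P0 PD PN Pc mu [a ->]; apply: big_ind => // k _.
have Pk : P (map (coroot dot) Phi)`_k.
  have := ltn_ord k; rewrite [X in (_ < X)%N]size_map => kP.
  by rewrite (nth_map 0)//; apply/Pc/mem_nth.
have Pn m : P ((map (coroot dot) Phi)`_k *+ m).
  by elim: m => [|m IH]; rewrite ?mulr0n// mulrSr; exact: PD.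
by case: (a k) => m; [exact: Pn|rewrite NegzE mulrNz; exact/PN/Pn].
Qed.

Lemma lattice_weyl w mu : W w -> L mu -> L (w mu).
Proof.
move=> Ww; elim/lattice_ind => [|x y|x|b bP].
- by rewrite weyl0//; exact: lattice0.
- by rewrite weylD//; exact: latticeD.
- by rewrite weylN//; exact: latticeN.
- have -> : w (coroot dot b) = coroot dot (w b) by rewrite !corootE weyl_dot// weylZ.
  exact/lattice_coroot/weyl_root.
Qed.

Lemma aff_reflE f x : aff_refl dot f x = reflection dot f.1 x - f.2 *: coroot dot f.1.
Proof.
by rewrite /aff_refl /aff reflection_coroot scalerDl opprD addrA.
Qed.

(** A simple affine reflection has its linear part in the Weyl group and translates by an integer
    multiple of a coroot. With [translation_word] this identifies the two descriptions of the affine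
    Weyl group. *)
Lemma word_translation s :
  exists mu w, [/\ L mu, W w & forall x, word_act s x = mu + w x].
Proof.
elim: s => [|j s [mu [w [Lm Ww E]]]].
  by exists 0, id; split=> [||x]; [exact: lattice0|exact: weyl_id|rewrite add0r].
have [jP /intrP[z zE]] := sroot_root j.
have Wr := weyl_reflection jP (weyl_id dot Phi).
exists (reflection dot (aff_simple j) mu - coroot dot (aff_simple j) *~ z).
exists (reflection dot (aff_simple j) \o w); split=> [||x].
- apply: latticeD; first exact: lattice_weyl Wr Lm.
  exact/latticeN/latticeM/lattice_coroot.
- exact: weyl_reflection.
- rewrite /= E aff_reflE zE /= -[reflection dot _ (mu + w x)]/((reflection dot _ \o id) _).
  by rewrite weylD// addrAC scaler_int.
Qed.

(** Translation by the coroot of [b] is the product of the reflections in the parallel hyperplanes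
    [(b, -1)] and [(b, 0)]. *)
Lemma translation_word mu w : L mu -> W w ->
  exists s, forall x, word_act s x = mu + w x.
Proof.
have linear_word v : W v -> exists s, word_act s =1 v.
  elim=> [|b u bP _ [s sE]]; first by exists [::].
  have [|t tE] := @refl_word (b, 0); first by split; rewrite /= ?rpred0.
  exists (t ++ s) => x; rewrite word_act_cat tE sE aff_reflE /=.
  by rewrite scale0r subr0.
move=> Lm /linear_word[s sE]; suff [t tE] : exists t, forall x, word_act t x = mu + x.
  by exists (t ++ s) => x; rewrite word_act_cat tE sE.
elim/lattice_ind : mu / Lm => [|x y [s1 E1] [s2 E2]|x [s1 E1]|b bP].
- by exists [::] => x; rewrite add0r.
- by exists (s1 ++ s2) => z; rewrite word_act_cat E1 E2 addrA.
- exists (rev s1) => z; have := word_act_rev s1 (z - x).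
  by rewrite E1 addrC subrK addrC.
- have [|t tE] := @refl_word (b, -1); first by split; rewrite /= ?rpredN ?rpred1.
  have Wb := weyl_reflection bP (weyl_id dot Phi).
  have [s1 E1] := linear_word _ Wb.
  exists (t ++ s1) => x; rewrite word_act_cat tE E1 aff_reflE /=.
  by rewrite reflectionK ?root_nz// scaleN1r opprK addrC.
Qed.

Lemma closed_alcove_inj mu w mu' w' x x' : L mu -> W w -> L mu' -> W w' ->
  closed_alcove x -> closed_alcove x' -> mu + w x = mu' + w' x' -> x = x'.
Proof.
move=> Lm Ww Lm' Ww' cx cx' E; have [v [Wv vK _]] := weyl_inv Ww'.
have [s sE] := translation_word (lattice_weyl Wv (latticeD Lm (latticeN Lm'))) (weyl_comp Wv Ww).
have sx : word_act s x = x'.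
  by rewrite sE /= -weylD// addrAC E addrAC subrr add0r vK.
by rewrite -sx closed_alcove_fixed// sx.
Qed.

Lemma alcove_inj mu w mu' w' x x' : L mu -> W w -> L mu' -> W w' ->
  alcove x -> alcove x' -> mu + w x = mu' + w' x' -> mu = mu' /\ w = w'.
Proof.
move=> Lm Ww Lm' Ww' ax ax' E; have [v [Wv vK v'K]] := weyl_inv Ww'.
have [s sE] := translation_word (lattice_weyl Wv (latticeD Lm (latticeN Lm'))) (weyl_comp Wv Ww).
have sx : word_act s x = x'.
  by rewrite sE /= -weylD// addrAC E addrAC subrr add0r vK.
have H y : mu + w y = mu' + w' y.
  have := @alcove_trivial s x ax; rewrite sx => /(_ ax' y).
  rewrite sE /= -weylD// => /(congr1 w'); rewrite v'K => <-.
  by rewrite [RHS]addrA [mu' + _]addrC subrK.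
(* Evaluation at the origin isolates the translation parts. *)
have mE : mu = mu' by have := H 0; rewrite (weyl0 Ww) (weyl0 Ww') !addr0.
by split=> //; apply/funext => y; have := H y; rewrite mE => /addrI.
Qed.

Lemma alcove_covering y : exists mu w x,
  [/\ L mu, W w, closed_alcove x & y = mu + w x].
Proof.
have [s sc] := word_to_closed_alcove y; have [mu [w [Lm Ww E]]] := word_translation (rev s).
by exists mu, w, (word_act s y); split=> //; rewrite -E word_act_rev.
Qed.

(** * The longest element and descents *)

Lemma weyl_sum w (F : 'I_n -> V) : W w -> w (\sum_i F i) = \sum_i w (F i).
Proof.
by move=> Ww; apply: (big_morph w); [move=> x y; exact: weylD|exact: weyl0].
Qed.

(** An element is determined by the images of the simple roots, which are again roots. *)
Lemma weyl_finite : finite_set W.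
Proof.
pose decode (t : {ffun 'I_n -> seq_sub Phi}) x := \sum_i coord alpha i x *: ssval (t i).
apply: (@sub_finite_set _ _ (decode @` setT)%classic); last first.
  by apply: finite_image; exact: finite_finset.
move=> w Ww; exists [ffun i => SeqSub (weyl_root Ww (simple_in i))] => //.
apply/funext => x; rewrite /decode.
rewrite [in RHS](coord_basis (simple_basis alpha_simple) (memvf x)) weyl_sum//.
by apply: eq_bigr => i _; rewrite ffunE /= weylZ// (tnth_nth 0).
Qed.

Lemma weyl_maximum (P : (V -> V) -> Prop) (h : (V -> V) -> R) w : W w -> P w ->
  exists v, [/\ W v, P v & forall u, W u -> P u -> h u <= h v].
Proof.
have /finite_seqP[s sE] := weyl_finite => Ww Pw.
suff [v [vs Pv vmax]] : exists v, [/\ v \in s, P v &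
    forall u, u \in s -> P u -> h u <= h v].
  by exists v; rewrite sE; split.
have : exists v, v \in s /\ P v by exists w; split=> //; move: Ww; rewrite sE.
elim: s {sE} => [[v []]//|v s IH] [u [us Pu]].
have [[m [ms Pm max]]|nex] := pselect (exists m, [/\ m \in s, P m &
    forall u, u \in s -> P u -> h u <= h m]).
  have [[Pv hv]|nv] := pselect (P v /\ h m <= h v).
    exists v; split; [exact: mem_head|exact: Pv|] => t; rewrite inE.
    by move=> /predU1P[->//|ts] Pt; apply: le_trans hv; exact: max.
  exists m; split; [by rewrite inE ms orbT|exact: Pm|] => t; rewrite inE.
  move=> /predU1P[->|ts] Pt; last exact: max.
  by rewrite leNgt; apply/negP => /ltW hv; apply: nv.
have ns t : t \in s -> ~ P t by move=> ts Pt; apply: nex; apply: IH; exists t.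
move: us; rewrite inE => /predU1P[uv|/ns//]; rewrite uv in Pu.
exists v; split=> // [|t]; first exact: mem_head.
by rewrite inE => /predU1P[->//|/ns].
Qed.

Lemma dot_alcove a i : alcove a -> 0 < dot a (tnth alpha i).
Proof. by move=> /(_ (lift ord0 i)); rewrite /aff /= aff_simple_lift addr0. Qed.

Lemma linear_root b : b \in Phi -> aff_root (b, 0).
Proof. by move=> bP; split; rewrite //= rpred0. Qed.

Lemma dot_regular a b : alcove a -> b \in Phi -> dot a b != 0.
Proof.
by move=> aa /linear_root/alcove_regular/(_ aa); rewrite /aff /= addr0.
Qed.

(** A point of the alcove serves as a generic dominant vector, so that descents are read off from
    signs of inner products. *)
Lemma negative_rootP a b : alcove a -> b \in Phi ->
  negative_root Phi alpha b <-> dot a b < 0.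
Proof.
move=> aa bP; split=> [[_ nb]|ab].
  have := aff_pos_gt0 (linear_root (root_opp bP)) (aff_pos_mk nb (lexx 0)) aa.
  by rewrite /aff /= addr0 dotNr oppr_gt0.
split=> //; have [nb|//] := simple_sign alpha_simple bP.
have := aff_pos_gt0 (linear_root bP) (aff_pos_mk nb (lexx 0)) aa.
by rewrite /aff /= addr0 ltNge ltW.
Qed.

(** Take [v] minimizing [<a, v a>]. No simple reflection lowers this further, so [v a] is
    antidominant, and the inverse of [v] has the required property. *)
Lemma longest_element a : alcove a -> exists w0, W w0 /\
  forall b, b \in Phi -> (dot a (w0 b) < 0) = ~~ (dot a b < 0).
Proof.
move=> aa.
have [v [Wv _ vmax]] := @weyl_maximum (fun=> True) (fun w => - dot a (w a)) _ (weyl_id _ _) I.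
have [w0 [Ww0 vK w0K]] := weyl_inv Wv.
have dE b : dot a (w0 b) = dot (v a) b by rewrite -(weyl_dot _ _ Wv) w0K.
have va i : dot (v a) (tnth alpha i) <= 0.
  have := vmax _ (weyl_reflection (simple_in i) Wv) I.
  rewrite /= lerN2 reflectionE dotDr dotNr dotZr lerDl oppr_ge0 pmulr_lle0; last exact: dot_alcove.
  by rewrite corootE dotZl dotC pmulr_rle0// divr_gt0// dot_gt0// root_nz// simple_in.
have pos b : b \in Phi -> 0 < dot a b -> dot a (w0 b) < 0.
  move=> bP ab; have [nb|nb] := simple_sign alpha_simple bP; last first.
    by have := (negative_rootP aa bP).1 (conj bP nb); rewrite ltNge ltW.
  rewrite lt_neqAle dot_regular ?weyl_root//= dE.
  have [c c0 ->] := nneg_combE nb; rewrite dot_sumr sumr_le0// => i _.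
  by rewrite dotZr mulr_ge0_le0.
exists w0; split=> // b bP; case: (ltP (dot a b) 0) => ab.
  apply/negbTE; rewrite -leNgt ltW//; have := pos _ (root_opp bP).
  by rewrite weylN// !dotNr oppr_gt0 oppr_lt0; apply.
by rewrite pos// lt_neqAle ab eq_sym dot_regular.
Qed.

Local Notation Des := (aff_descents Phi alpha theta).

Lemma mem_descents a w j : alcove a -> W w -> (j \in Des w) = (dot a (w (aff_simple j)) < 0).
Proof.
move=> aa Ww; rewrite inE.
have bP : w (aff_simple j) \in Phi by apply: weyl_root => //; exact: (sroot_root j).1.
by apply/asboolP/idP => [/(negative_rootP aa bP)//|?]; exact/negative_rootP.
Qed.

Lemma descents_complement : exists2 w0, W w0 &
  forall w, W w -> Des (w0 \o w) = (~: Des w)%SET.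
Proof.
have [a aa] := alcove_nonempty; have [w0 [Ww0 H]] := longest_element aa.
exists w0 => // w Ww; apply/setP => j; rewrite finset.in_setC.
rewrite (mem_descents _ aa (weyl_comp Ww0 Ww)) (mem_descents _ aa Ww) /= H//.
by apply: weyl_root => //; exact: (sroot_root j).1.
Qed.

(** * Cells, closures and colors *)

Lemma same_cellP x y : same_cell dot Phi x y <->
  forall f, aff_root f -> Num.sg (aff dot f x) = Num.sg (aff dot f y).
Proof.
split=> [H [b k] [/= bP /intrP[z ->]]|H b k bP].
  by have := H b (- z) bP; rewrite mulrNz opprK.
by apply: (H (b, - k%:~R)); split; rewrite //= rpredN intr_int.
Qed.

Lemma same_cell_translation mu w x y : L mu -> W w -> same_cell dot Phi x y ->
  same_cell dot Phi (mu + w x) (mu + w y).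
Proof.
move=> Lm Ww /same_cellP H; apply/same_cellP => f fr.
have [s sE] := translation_word Lm Ww; have [g gr gE] := word_pullback s fr.
by rewrite -!sE -!gE H.
Qed.

Lemma alcove_faceE J : alcove_face dot alpha theta J = face J.
Proof.
apply/funext => x; apply/propext; split=> [[H1 H0] j|H].
  case: (unliftP ord0 j) => [i|] ->.
    by rewrite /aff /= aff_simple_lift addr0; exact: H1.
  by move: H0; rewrite /aff /= aff_simple0 dotNr; case: ifP => _ => [->|]; 
    rewrite ?addNr// addrC subr_gt0.
split=> [i|].
  by have := H (lift ord0 i); rewrite /aff /= aff_simple_lift addr0.
have := H ord0; rewrite /aff /= aff_simple0 dotNr addrC; case: ifP => _.
  by move/eqP; rewrite subr_eq0 => /eqP.
by rewrite subr_gt0.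
Qed.

Lemma closed_alcove_face x : closed_alcove x -> exists J, face J x.
Proof.
move=> cx; exists [set j | aff dot (sroot j) x == 0]%SET => j.
rewrite inE; case: eqP => [->//|/eqP x0]; by rewrite lt_neqAle eq_sym x0 cx.
Qed.

(** Up to sign an affine root is a nonnegative combination of walls. On the face it vanishes if only
    walls in [J] occur in it and is positive otherwise. *)
Lemma face_same_cell J x y : face J x -> same_cell dot Phi x y <-> face J y.
Proof.
move=> fx; split=> [/same_cellP H j|fy].
  have := fx j; have := H _ (sroot_root j); case: ifP => _ sxy xj.
    by move/esym/eqP: sxy; rewrite xj sgr0 sgr_eq0 => /eqP.
  by rewrite -sgr_gt0 -sxy sgr_gt0.
have zero (m : 'I_n.+1 -> R) u v : (forall j, 0 <= m j) -> face J u -> face J v ->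
    aff dot (\sum_j m j *: aff_simple j, m ord0) u = 0 ->
    aff dot (\sum_j m j *: aff_simple j, m ord0) v = 0.
  move=> m0 fu fv u0; rewrite aff_sum big1// => j _.
  have [jJ|jJ] := boolP (j \in J); first by have := fv j; rewrite jJ => ->; rewrite mulr0.
  by rewrite (aff_pos_eq0 m0 fu u0)// mul0r.
have pos f : aff_pos f -> Num.sg (aff dot f x) = Num.sg (aff dot f y).
  move=> fp; have [m m0 fE] := fp.
  have := aff_pos_ge0 fp (face_closed fx); rewrite le0r => /predU1P[x0|x0].
    by rewrite x0; move: x0; rewrite fE => /(zero _ _ _ m0 fx fy) ->.
  have := aff_pos_ge0 fp (face_closed fy); rewrite le0r => /predU1P[y0|y0].
    by rewrite y0; move: y0; rewrite fE => /(zero _ _ _ m0 fy fx) ->.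
  by rewrite !gtr0_sg.
apply/same_cellP => f /aff_pos_or[|] /pos//.
by rewrite !affN !sgrN => /oppr_inj.
Qed.

Lemma cellE mu w J x : L mu -> W w -> face J x ->
  [set y | same_cell dot Phi (mu + w x) y]%classic =
  translate mu (w @` alcove_face dot alpha theta J).
Proof.
move=> Lm Ww fx; rewrite alcove_faceE; apply/seteqP; split=> [y /= xy|_ [_ [y fy <-] <-]].
  have [v [Wv vK wK]] := weyl_inv Ww.
  have yE : mu + w (v (- mu) + v y) = y by rewrite -weylD// wK addNKr.
  exists (w (v (- mu) + v y)) => //; exists (v (- mu) + v y) => //.
  apply/(face_same_cell _ fx).
  have := same_cell_translation (lattice_weyl Wv (latticeN Lm)) Wv xy.
  by rewrite (weylD _ _ Wv) vK (weylN _ Wv) addKr.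
exact/same_cell_translation/(face_same_cell _ fx).
Qed.

Lemma face_closure J x : closed_alcove x -> (exists y, face J y) ->
  (forall j, j \in J -> aff dot (sroot j) x = 0) ->
  cell_closure dot (face J) x.
Proof.
move=> cx [y fy] xJ e e0; set d := dot (y - x) (y - x).
(* The approximating point lies on the segment from [x] to [y]. With [t = min(1, e / (d + 1))] one
   has [t * t * d <= t * d < t * (d + 1) <= e]. *)
have [t [t0 t1 te]] : exists t : R, [/\ 0 < t, t <= 1 & t * t * d < e].
  have d0 : 0 <= d by exact: dot_ge0.
  have d1 : 0 < d + 1 by lra.
  have t0 : 0 < Num.min 1 (e / (d + 1)) by rewrite lt_min ltr01 divr_gt0.
  have t1 : Num.min 1 (e / (d + 1)) <= 1 by rewrite ge_min lexx.
  have te : Num.min 1 (e / (d + 1)) * (d + 1) <= e.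
    by rewrite -ler_pdivlMr// ge_min lexx orbT.
  exists (Num.min 1 (e / (d + 1))); split=> //.
  move: (Num.min _ _) t0 t1 te => t t0 t1 te.
  have td : t * t * d <= 1 * (t * d) by rewrite -mulrA ler_wpM2r// mulr_ge0// ltW.
  by lra.
exists (x + t *: (y - x)); last first.
  rewrite opprD addrA subrr sub0r !(dotNl, dotNr) opprK dotZl dotZr mulrA.
  exact: te.
move=> j; rewrite aff_add dotZl dotDl dotNl.
have -> : aff dot (sroot j) x + t * (dot y (sroot j).1 - dot x (sroot j).1) =
    (1 - t) * aff dot (sroot j) x + t * aff dot (sroot j) y by rewrite /aff; ring.
have := fy j; case: ifP => jJ; first by move=> ->; rewrite xJ// !mulr0 addr0.
move=> y0; apply: ltr_wpDl; last exact: mulr_gt0.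
by apply: mulr_ge0 (cx j); rewrite subr_ge0.
Qed.

(** Closed half-spaces are closed: by Cauchy-Schwarz, a point with negative value keeps a definite
    distance from the half-space. *)
Lemma closure_aff (s : set V) f x : f.1 != 0 -> cell_closure dot s x ->
  (forall y, s y -> 0 <= aff dot f y) -> 0 <= aff dot f x.
Proof.
move=> f0 sx H; rewrite leNgt; apply/negP => x0.
have ff := dot_gt0 dot f0.
have [|y /H y0 d] := sx (aff dot f x ^+ 2 / dot f.1 f.1).
  by rewrite divr_gt0// exprn_even_gt0//= lt_eqF.
move: d; rewrite ltr_pdivlMr// => d.
have := le_lt_trans (dot_CS dot (x - y) f.1) d.
have -> : dot (x - y) f.1 = aff dot f x - aff dot f y by rewrite /aff !dotE; ring.
nra.
Qed.

Lemma closure_isometry mu w (s : set V) x : W w ->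
  cell_closure dot (translate mu (w @` s)) (mu + w x) <-> cell_closure dot s x.
Proof.
move=> Ww.
have dE y : dot (mu + w x - (mu + w y)) (mu + w x - (mu + w y)) = dot (x - y) (x - y).
  by rewrite opprD addrACA subrr add0r -(weylN y Ww) -(weylD _ _ Ww) weyl_dot.
split=> H e /H[y]; first by move=> [_ [z sz <-] <-]; rewrite dE; exists z.
by move=> sy xy; exists (mu + w y); rewrite ?dE//; exists (w y) => //; exists y.
Qed.

(** A vertex of color [j] in the closure is moved back into the closed alcove, where strictness of
    the fundamental domain makes it the standard vertex of color [j]. That vertex is off wall [j]
    and on all others, so it is in the closure exactly when [j] is not in [J]. *)
Lemma color_setE mu w J : L mu -> W w -> J != [set: 'I_n.+1]%SET ->
  color_set dot Phi alpha theta
    (translate mu (w @` alcove_face dot alpha theta J)) = (~: J)%SET.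
Proof.
move=> Lm Ww /face_nonempty[y fy]; rewrite alcove_faceE.
apply/setP => j; rewrite !finset.inE; apply/asboolP/idP => [[_ [nu [v [Ln Wv ->]]]]|jJ].
  have [|x fx] := @face_nonempty (~: [set j])%SET.
    by apply/eqP => /setP/(_ j); rewrite !inE eqxx.
  rewrite alcove_faceE => sub.
  have {sub} : cell_closure dot (translate mu (w @` face J)) (nu + v x).
    by apply: sub; exists (v x) => //; exists x.
  have [u [Wu wK uK]] := weyl_inv Ww; pose z := u (- mu + (nu + v x)).
  have zE : nu + v x = mu + w z by rewrite uK addNKr.
  rewrite zE => /(closure_isometry _ _ _ Ww) cz.
  have zc : closed_alcove z.
    by move=> i; apply: closure_aff (sroot_nz i) cz _ => t /face_closed/(_ i).
  have xz := closed_alcove_inj Ln Wv Lm Ww (face_closed fx) zc zE.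
  apply/negP => jJ; have := fx j; rewrite !inE eqxx /= ltNge => /negP; apply.
  rewrite -oppr_ge0 -affN xz; apply: closure_aff cz _ => [|t /(_ j)].
    by rewrite /= oppr_eq0 sroot_nz.
  by rewrite jJ affN => ->; rewrite oppr0.
exists (translate mu (w @` alcove_face dot alpha theta (~: [set j])%SET)).
  by exists mu, w.
rewrite alcove_faceE => _ [_ [x fx <-] <-]; apply/closure_isometry => //.
apply: face_closure (face_closed fx) _ _ => [|k kJ]; first by exists y.
have := fx k; rewrite !inE; case: eqVneq => // kj.
by move: jJ; rewrite -kj kJ.
Qed.

(** * Cells of the Steinberg torus and descents *)

Local Notation torus_class := (torus_class dot Phi).
Local Notation torus_face J w := (torus_class (w @` alcove_face dot alpha theta (~: J)%SET)).

Lemma translate0 (s : set V) : translate 0 s = s.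
Proof.
apply/seteqP; split=> [_ [x sx <-]|x sx]; first by rewrite add0r.
by exists x => //; rewrite add0r.
Qed.

Lemma torus_class_refl s : torus_class s s.
Proof. by exists 0; [exact: lattice0|rewrite translate0]. Qed.

Lemma torus_class_translate mu s : L mu -> torus_class (translate mu s) = torus_class s.
Proof.
move=> Lm; have tD nu : translate nu (translate mu s) = translate (nu + mu) s.
  apply/seteqP; split=> [_ [_ [x sx <-] <-]|_ [x sx <-]].
    by exists x => //; rewrite addrA.
  by exists (mu + x); [exists x|rewrite addrA].
apply/seteqP; split=> [_ [nu Ln <-]|_ [nu Ln <-]].
  by exists (nu + mu); [exact: latticeD|rewrite tD].
exists (nu - mu); first by apply: latticeD => //; exact: latticeN.
by rewrite tD subrK.
Qed.

(** The vectors [w (aff_simple j)] satisfy a linear relation with positive coefficients, so they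
    cannot all pair positively with [a]. This keeps the empty cell out of the count. *)
Lemma descents_neq0 w : W w -> Des w != finset.set0.
Proof.
move=> Ww; apply/eqP => /setP D0; have [a aa] := alcove_nonempty.
have [c [c0 _ cE]] := marks.
have : 0 < \sum_j c j * dot a (w (aff_simple j)).
  have pos j : 0 < c j * dot a (w (aff_simple j)).
    apply: mulr_gt0 => //; rewrite lt_neqAle eq_sym dot_regular//=; last first.
      by apply: weyl_root => //; exact: (sroot_root j).1.
    by rewrite leNgt -mem_descents// D0 inE.
  by rewrite (bigD1 ord0)//= ltr_pwDl// sumr_ge0// => j _; exact: ltW.
have -> : \sum_j c j * dot a (w (aff_simple j)) = dot a (w (\sum_j c j *: aff_simple j)).
  rewrite (big_morph w (fun x y => weylD x y Ww) (weyl0 Ww)) dot_sumr.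
  by apply: eq_bigr => j _; rewrite weylZ// dotZr.
by rewrite cE weyl0// dot0r ltxx.
Qed.

Lemma setC_descents J w : W w -> Des w \subset J -> (~: J)%SET != [set: 'I_n.+1]%SET.
Proof.
move=> Ww wJ; apply: contra (descents_neq0 Ww).
by rewrite -finset.setC0 => /eqP/finset.setC_inj J0; rewrite -finset.subset0 -J0.
Qed.

Lemma face_setT x : ~ face [set: 'I_n.+1]%SET x.
Proof.
move=> fx; have [c [_ _ /(_ x)]] := aff_marks.
rewrite big1 => [/esym/eqP|j _]; first by rewrite oner_eq0.
by have := fx j; rewrite inE => ->; rewrite mulr0.
Qed.

(** Walls in [J] are positive at [x] and stay so for small [t]. The others vanish at [x] and
    increase along [w' a], since they are not descents of [w]. *)
Lemma face_perturb J a w w' x : alcove a -> W w -> cancel w' w ->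
  Des w \subset J -> face (~: J)%SET x ->
  exists2 e, 0 < e & forall t, 0 < t -> t < e -> alcove (x + t *: w' a).
Proof.
move=> aa Ww w'K DJ fx; pose d j := dot a (w (aff_simple j)).
pose F j := if j \in J then aff dot (sroot j) x / (`|d j| + 1) else 1.
have d1 j : 0 < `|d j| + 1 by rewrite ltr_wpDl.
have F0 j : 0 < F j.
  rewrite /F; case: ifP => // jJ; apply: divr_gt0 => //.
  by have := fx j; rewrite finset.in_setC jJ.
have [e e0 eF] := pos_minimum ord0 F0; exists e => // t t0 te j.
rewrite aff_add dotZl -(weyl_dot _ _ Ww) w'K -/(d j).
have := eF j; have := fx j; rewrite /F finset.in_setC; case: (boolP (j \in J)) => jJ /=.
  move=> x0; rewrite ler_pdivlMr// => eF'.
  have : t * (`|d j| + 1) < aff dot (sroot j) x by apply: lt_le_trans eF'; rewrite ltr_pM2r.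
  have : - `|d j| <= d j by rewrite lerNl -normrN ler_norm.
  by move=> /(ler_wpM2l (ltW t0)); lra.
move=> -> _; rewrite add0r mulr_gt0// lt_neqAle eq_sym dot_regular//=; last first.
  by apply: weyl_root => //; exact: (sroot_root j).1.
by rewrite leNgt -mem_descents//; apply: contra jJ; move/fintype.subsetP: DJ; apply.
Qed.

(** Pushing a common point [w x = mu + v x'] in the direction [a] leads into both alcoves, that of
    [w] and that of [v] translated by [mu]; hence these coincide. *)
Lemma torus_face_inj J w v : W w -> W v -> Des w \subset J -> Des v \subset J ->
  torus_face J w = torus_face J v -> w = v.
Proof.
move=> Ww Wv wJ vJ E; have [a aa] := alcove_nonempty.
have JT := setC_descents Ww wJ.
have [x fx] := face_nonempty JT.
have := torus_class_refl (w @` alcove_face dot alpha theta (~: J)%SET); rewrite E.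
rewrite alcove_faceE => -[mu Lm] /seteqP[_ /(_ (w x))].
have wx : (w @` face (~: J)%SET)%classic (w x) by exists x.
move=> /(_ wx)[_ [x' fx' <-] xx'].
have [w' [Ww' wK w'K]] := weyl_inv Ww; have [v' [Wv' vK v'K]] := weyl_inv Wv.
have [e e0 eP] := face_perturb aa Ww w'K wJ fx.
have [e' e'0 eP'] := face_perturb aa Wv v'K vJ fx'.
pose t := Num.min e e' / 2.
have m0 : 0 < Num.min e e' by rewrite lt_min e0.
have t0 : 0 < t by rewrite divr_gt0.
have tm : t < Num.min e e' by rewrite ltr_pdivrMr// mulr_natr mulr2n ltrDl.
move: (tm); rewrite lt_min => /andP[te te'].
have [] := @alcove_inj 0 w mu v _ _ lattice0 Ww Lm Wv (eP t t0 te) (eP' t t0 te') => //.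
by rewrite (weylD _ _ Ww) (weylD _ _ Wv) (weylZ _ _ Ww) (weylZ _ _ Wv) w'K v'K add0r addrA xx'.
Qed.

Lemma torus_face_reduced J w : W w -> Des w \subset J ->
  reduced_steinberg_torus dot Phi (torus_face J w) /\
  torus_color dot Phi alpha theta (torus_face J w) J.
Proof.
move=> Ww wJ; have JT := setC_descents Ww wJ.
have [x fx] := face_nonempty JT.
have cs : coxeter_cell dot Phi (w @` alcove_face dot alpha theta (~: J)%SET).
  right; exists (0 + w x); rewrite (cellE lattice0 Ww fx); exact/esym/translate0.
split; last first.
  exists (w @` alcove_face dot alpha theta (~: J)%SET)%classic => //; split=> //.
  have := color_setE lattice0 Ww JT; rewrite translate0 => ->.
  exact: finset.setCK.
split; first by exists (w @` alcove_face dot alpha theta (~: J)%SET)%classic.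
move=> E; have := torus_class_refl (w @` alcove_face dot alpha theta (~: J)%SET).
rewrite E => -[mu _]; rewrite /translate image_set0 => /seteqP[_ /(_ (w x))]; apply.
by exists x => //; rewrite alcove_faceE.
Qed.

Lemma torus_face_surj J c : reduced_steinberg_torus dot Phi c ->
  torus_color dot Phi alpha theta c J ->
  exists w, [/\ W w, Des w \subset J & c = torus_face J w].
Proof.
move=> [_ cn0] [s [s0|[x sx]] [cs sJ]]; first by case: cn0; rewrite cs s0.
have [mu [w [p [Lm Ww cp xE]]]] := alcove_covering x.
have [K fp] := closed_alcove_face cp.
have KT : K != [set: 'I_n.+1]%SET.
  by apply/eqP => KT; apply: (@face_setT p); rewrite -KT.
have sE : s = translate mu (w @` alcove_face dot alpha theta K).
  by rewrite sx xE (cellE Lm Ww fp).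
have KJ : K = (~: J)%SET by rewrite -sJ sE color_setE// finset.setCK.
have [y ay] := alcove_nonempty.
(* Among all [v] that represent the cell, take the one whose alcove lies farthest in the direction
   [y], as measured from the face by [v (y - p)]. *)
pose P v := exists2 nu, L nu & s = translate nu (v @` alcove_face dot alpha theta K).
have Pw : P w by exists mu.
have [v [Wv [nu Ln snu] vmax]] := weyl_maximum (fun v => dot y (v (y - p))) Ww Pw.
exists v; split=> //; last by rewrite -KJ cs snu torus_class_translate.
apply/fintype.subsetP => j; rewrite (mem_descents _ ay Wv) => dj.
rewrite -[J]finset.setCK -KJ finset.in_setC; apply/negP => jK.
have [jP /intrP[z zE]] := sroot_root j.
pose b := aff_simple j; have bP : b \in Phi by [].
have Wu : W (v \o reflection dot b) := weyl_comp Wv (weyl_reflection bP (weyl_id _ _)).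
(* The affine reflection in a wall [j] with [j] in [K] fixes the face pointwise, so composing with
   it represents the same cell. As [j] is a descent, this would increase the maximum. *)
have : P (v \o reflection dot b).
  exists (nu - v (coroot dot b *~ z)).
    by apply/latticeD/latticeN/lattice_weyl/latticeM/lattice_coroot.
  have vE u : face K u -> nu + v u = nu - v (coroot dot b *~ z) + v (reflection dot b u).
    move=> /(_ j); rewrite jK => /aff_refl_fix.
    rewrite aff_reflE zE scaler_int /= -/b => {1}<-.
    by rewrite (weylD _ _ Wv) (weylN _ Wv) addrA addrAC.
  rewrite snu alcove_faceE; apply/seteqP; split=> _ [_ [u fu <-] <-].
    by rewrite vE//; exists ((v \o reflection dot b) u) => //; exists u.
  by rewrite /= -vE//; exists (v u) => //; exists u.
move=> /(vmax _ Wu); apply/negP; rewrite -ltNge /=.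
have : 0 < dot b (y - p).
  have := fp j; have := ay j; rewrite jK /aff /= -/b (dotC dot b) dotDl dotNl.
  by move=> y0 /eqP; rewrite addr_eq0 => /eqP ->; rewrite opprK.
move: (y - p) => q bq.
rewrite reflectionE (weylD _ _ Wv) (weylN _ Wv) (weylZ _ _ Wv) dotDr dotNr dotZr.
rewrite ltrDl oppr_gt0 pmulr_rlt0// corootE dotZl mulr_gt0//.
by rewrite divr_gt0// dot_gt0// root_nz.
Qed.

(** * Flag vectors and the Eulerian polynomial as sums over descent sets *)

Lemma flag_f_descents J :
  flag_f dot Phi alpha theta (reduced_steinberg_torus dot Phi) J =
  #|` fset_set [set w | W w /\ Des w \subset J]%classic|.
Proof.
rewrite /flag_f; set A := [set w | W w /\ _]%classic.
have -> : [set c | reduced_steinberg_torus dot Phi c /\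
    torus_color dot Phi alpha theta c J]%classic = ((fun w => torus_face J w) @` A)%classic.
  apply/seteqP; split=> [c [cr /(torus_face_surj cr)[w [Ww wJ ->]]]|_ [w [Ww wJ] <-]].
    by exists w.
  exact: torus_face_reduced.
have fA : finite_set A by apply: sub_finite_set weyl_finite => w [].
apply/fcard_eq => //; first exact: finite_image.
apply: inj_card_eq => w v; rewrite !inE => -[Ww wJ] [Wv vJ].
exact: torus_face_inj.
Qed.

(** Writing the count as a sum of indicators allows the sums over [I] and over [w] to be
    exchanged. *)
Lemma card_descents (P : pred {set 'I_n.+1}) :
  #|` fset_set [set w | W w /\ P (Des w)]%classic|%:Z =
  \sum_(w <- fset_set W) (P (Des w))%:Z.
Proof.
set A := [set w | W w /\ _]%classic.
have fA : finite_set A by apply: sub_finite_set weyl_finite => w [].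
have AE : perm_eq (fset_set A) [seq w <- fset_set W | P (Des w)].
  apply: uniq_perm => [||w]; rewrite ?filter_uniq//.
  rewrite mem_filter !in_fset_set//; last exact: weyl_finite.
  by apply/idP/idP => [/set_mem[Ww ->]|/andP[Pw /set_mem Ww]]; exact/mem_set.
rewrite (perm_size AE) size_filter -sum1_count big_mkcond /= -natz natr_sum.
by apply: eq_bigr => w _; case: (P _).
Qed.

Lemma flag_h_descents J :
  flag_h dot Phi alpha theta (reduced_steinberg_torus dot Phi) J =
  \sum_(w <- fset_set W) (Des w == J)%:Z.
Proof.
rewrite /flag_h.
under eq_bigr => I _ do
  rewrite flag_f_descents (card_descents (fun D => D \subset I)) mulr_sumr.
by rewrite exchange_big; apply: eq_bigr => w _; exact: moebius_subsets.
Qed.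

(** Reindexing by left multiplication with the longest element. Both symmetries are instances, with
    [F] an indicator or a power of [t]. *)
Lemma sum_descents_complement (A : zmodType) (F : {set 'I_n.+1} -> A) :
  \sum_(w <- fset_set W) F (Des w) = \sum_(w <- fset_set W) F (~: Des w)%SET.
Proof.
have [w0 Ww0 w0C] := descents_complement; have [v [Wv vK w0K]] := weyl_inv Ww0.
rewrite -!(fsbig_finite _ _ weyl_finite).
rewrite (@reindex_fsbig _ _ _ _ _ (fun w => w0 \o w) W W).
  by apply: eq_fsbigr => w /set_mem Ww; rewrite w0C.
split=> [w Ww|w u _ _ E|w Ww]; first exact: weyl_comp.
  by apply/funext => x; have := congr1 (fun g => v (g x)) E; rewrite /= !vK.
by exists (v \o w); [exact: weyl_comp|apply/funext => x /=; rewrite w0K].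
Qed.

Lemma flag_h_complement J :
  flag_h dot Phi alpha theta (reduced_steinberg_torus dot Phi) J =
  flag_h dot Phi alpha theta (reduced_steinberg_torus dot Phi) (~: J)%SET.
Proof.
rewrite !flag_h_descents (sum_descents_complement (fun D => (D == J)%:Z)).
by apply: eq_bigr => w _; rewrite -(inj_eq (@finset.setC_inj _)) finset.setCK.
Qed.

Lemma horner_eulerian (F : fieldType) (t : F) :
  (map_poly intr (aff_eulerian dot Phi alpha theta)).[t] =
  \sum_(w <- fset_set W) t ^+ #|Des w|.
Proof.
rewrite /aff_eulerian (fsbig_finite _ _ weyl_finite) rmorph_sum horner_sum.
by apply: eq_bigr => w _; rewrite /= map_polyXn hornerXn.
Qed.

Lemma horner_eulerian_inv (F : fieldType) (t : F) : t != 0 ->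
  (map_poly intr (aff_eulerian dot Phi alpha theta)).[t] =
  t ^+ n.+1 * (map_poly intr (aff_eulerian dot Phi alpha theta)).[t^-1].
Proof.
move=> t0; rewrite !horner_eulerian (sum_descents_complement (fun D => t ^+ #|D|)).
rewrite mulr_sumr; apply: eq_bigr => w _.
(* The exponent [n.+1] is the size of [Des w] plus that of its complement. *)
rewrite -[X in t ^+ X * _](card_ord n.+1) -(cardsC (Des w)).
by rewrite exprD mulrAC exprVn divff ?mul1r// expf_neq0.
Qed.

End AffineRoots.

Theorem corollary3p2 (R : realType) (V : vectType R) (dot : {dot V for idfun})
    (Phi : seq V) (n : nat) (alpha : n.-tuple V) (theta : V)
    (Phi_root : root_system dot Phi)
    (Phi_irr : irreducible_root_system dot Phi)
    (alpha_simple : simple_system Phi alpha)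
    (theta_highest : highest_root Phi alpha theta) :
  (forall J : {set 'I_n.+1},
     flag_h dot Phi alpha theta (reduced_steinberg_torus dot Phi) J =
     flag_h dot Phi alpha theta (reduced_steinberg_torus dot Phi) (~: J)%SET)
  /\
  (forall (F : fieldType) (t : F), t != 0 ->
     let P := map_poly intr (aff_eulerian dot Phi alpha theta) : {poly F} in
     P.[t] = t ^+ n.+1 * P.[t^-1]).
Proof.
split=> [J|F t t0 /=]; first exact: flag_h_complement.
exact: horner_eulerian_inv.
Qed.
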